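(* Let $k\ge1$ and $\Upsilon=\{(1\text{-}2,1~0),(1\text{-}2,0~1)\}$. Let $A_k^{\Upsilon}(t)=\sum_{n\ge0}Av_{n,k}^{\Upsilon}t^n$ (with $Av_{0,k}^\Upsilon=1$) and $C(t)=\sum_{n\ge1}n!\,t^n$. Then, as formal power series in $t$, $$A_k^{\Upsilon}(t)=\frac{1+C(t)}{1-(k-1)C(t)}.$$
   Context: For integers $k\ge1$, $n\ge0$, $C_k\wr S_n$ denotes the set of pairs $(\sigma,w)$ where $\sigma=\sigma_1\cdots\sigma_n$ is a permutation of $\{1,\dots,n\}$ in one-line notation and $w=w_1\cdots w_n\in\{0,1,\dots,k-1\}^n$. $(\sigma,w)$ bi-avoids $(1\text{-}2,1~0)$ if there are no $i<j$ with $\sigma_i<\sigma_j$ and $w_i>w_j$, and bi-avoids $(1\text{-}2,0~1)$ if there are no $i<j$ with $\sigma_i<\sigma_j$ and $w_i<w_j$. $Av_{n,k}^{\Upsilon}$ is the number of elements of $C_k\wr S_n$ bi-avoiding both patterns of $\Upsilon$. *)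

(* Defs.v *)
From HB Require Import structures.
From mathcomp Require Import all_boot all_order all_algebra all_fingroup.
From mathcomp Require Import boolp.

Set Implicit Arguments.
Unset Strict Implicit.
Unset Printing Implicit Defensive.

Import Order.TTheory GRing.Theory Num.Theory.
Local Open Scope ring_scope.

(* The ring R[[t]] of formal power series.  The classical axioms of boolp     *)
(* supply extensionality of coefficient sequences and the choice structure    *)
(* required by the algebraic hierarchy.                                       *)

Record fps (R : Type) := FPS { fps_coef : nat -> R }.

Lemma fpsP (R : Type) (f g : fps R) : fps_coef f =1 fps_coef g <-> f = g.
Proof.
split=> [|-> //]; case: f => f; case: g => g /= fg.
by congr FPS; apply/funext.
Qed.

HB.instance Definition _ (R : Type) := gen_eqMixin (fps R).
HB.instance Definition _ (R : Type) := gen_choiceMixin (fps R).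

Section FpsRing.
Variable R : comUnitRingType.
Implicit Types f g h : fps R.

Definition fps_zero : fps R := FPS (fun=> 0).
Definition fps_opp f : fps R := FPS (fun n => - fps_coef f n).
Definition fps_add f g : fps R := FPS (fun n => fps_coef f n + fps_coef g n).
Definition fps_one : fps R := FPS (fun n => (n == 0)%:R).
Definition fps_mul f g : fps R :=
  FPS (fun n => \sum_(i < n.+1) fps_coef f i * fps_coef g (n - i)).

Fact fps_addA : associative fps_add.
Proof. by move=> f g h; apply/fpsP => n; apply: addrA. Qed.
Fact fps_addC : commutative fps_add.
Proof. by move=> f g; apply/fpsP => n; apply: addrC. Qed.
Fact fps_add0 : left_id fps_zero fps_add.
Proof. by move=> f; apply/fpsP => n; apply: add0r. Qed.
Fact fps_addN : left_inverse fps_zero fps_opp fps_add.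
Proof. by move=> f; apply/fpsP => n; apply: addNr. Qed.

HB.instance Definition _ :=
  GRing.isZmodule.Build (fps R) fps_addA fps_addC fps_add0 fps_addN.

Let trunc n f : {poly R} := \poly_(i < n.+1) fps_coef f i.

Let coef_trunc n f i : (i <= n)%N -> (trunc n f)`_i = fps_coef f i.
Proof. by move=> le_in; rewrite coef_poly ltnS le_in. Qed.

Let coef_truncM n f g i :
  (i <= n)%N -> (trunc n f * trunc n g)`_i = fps_coef (fps_mul f g) i.
Proof.
move=> le_in; rewrite coefM /=; apply: eq_bigr => j _.
rewrite !coef_trunc ?(leq_trans (leq_subr _ _)) //.
by rewrite (leq_trans _ le_in) // -ltnS.
Qed.

Fact fps_mulC : commutative fps_mul.
Proof.
move=> f g; apply/fpsP => n.
by rewrite -(@coef_truncM n) // mulrC coef_truncM.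
Qed.

Fact fps_mulA : associative fps_mul.
Proof.
move=> f g h; apply/fpsP => n.
transitivity ((trunc n f * (trunc n g * trunc n h))`_n).
  rewrite coefM /=; apply: eq_bigr => j _.
  by rewrite coef_trunc -1?ltnS // coef_truncM // leq_subr.
rewrite mulrA coefM /=; apply: eq_bigr => j _.
by rewrite coef_truncM -1?ltnS // coef_trunc // leq_subr.
Qed.

Fact fps_mul1 : left_id fps_one fps_mul.
Proof.
move=> f; apply/fpsP => n /=.
rewrite big_ord_recl /= subn0 mul1r big1 ?addr0 // => i _.
by rewrite mul0r.
Qed.

Fact fps_mulDl : left_distributive fps_mul fps_add.
Proof.
move=> f g h; apply/fpsP => n /=; rewrite -big_split /=.
by apply: eq_bigr => i _; rewrite mulrDl.
Qed.

Fact fps_one_neq0 : fps_one != 0 :> fps R.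
Proof.
by apply/eqP => /fpsP/(_ 0%N) /= /eqP; rewrite oner_eq0.
Qed.

HB.instance Definition _ :=
  GRing.Zmodule_isComNzRing.Build (fps R)
    fps_mulA fps_mulC fps_mul1 fps_mulDl fps_one_neq0.

(* A series is invertible iff its constant coefficient is.  The coefficients  *)
(* of the inverse g of f are g_0 = f_0^-1 and                                 *)
(* g_n = - f_0^-1 * \sum_(i < n) f_(n - i) g_i; fps_inv_seq f n lists         *)
(* g_0, ..., g_n.                                                             *)
Fixpoint fps_inv_seq f n : seq R :=
  if n is m.+1 then
    let s := fps_inv_seq f m in
    rcons s (- (fps_coef f 0)^-1 * \sum_(i < n) fps_coef f (n - i) * s`_i)
  else [:: (fps_coef f 0)^-1].

Definition fps_unit : {pred fps R} :=
  fun f => fps_coef f 0 \is a GRing.unit.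

(* As everywhere in MathComp, the inverse of a non-unit is itself.            *)
Definition fps_inv f : fps R :=
  if f \in fps_unit then FPS (fun n => (fps_inv_seq f n)`_n) else f.

Let size_inv_seq f n : size (fps_inv_seq f n) = n.+1.
Proof. by elim: n => //= n IHn; rewrite size_rcons IHn. Qed.

Let nth_inv_seq f n i :
  (i <= n)%N -> (fps_inv_seq f n)`_i = (fps_inv_seq f i)`_i.
Proof.
elim: n => [|n IHn]; first by rewrite leqn0 => /eqP->.
rewrite leq_eqVlt => /predU1P[-> // | lt_in].
by rewrite [fps_inv_seq f n.+1]/= nth_rcons size_inv_seq lt_in IHn.
Qed.

Fact fps_mulVx : {in fps_unit, left_inverse 1 fps_inv *%R}.
Proof.
move=> f Uf; have Uf0 : fps_coef f 0 \is a GRing.unit by [].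
apply/fpsP => -[|n]; rewrite /= /fps_inv Uf /=.
  by rewrite big_ord1 /= mulVr.
rewrite big_ord_recr /= subnn nth_rcons size_inv_seq ltnn eqxx.
rewrite mulrAC mulNr mulVr // mulN1r.
apply/eqP; rewrite subr_eq add0r; apply/eqP; apply: eq_bigr => i _ /=.
by rewrite mulrC (@nth_inv_seq f n i) // -ltnS.
Qed.

Fact fps_unitPl f g : g * f = 1 -> fps_unit f.
Proof.
move=> /fpsP/(_ 0%N) /=; rewrite big_ord1 /= => gf1.
by apply/unitrPr; exists (fps_coef g 0); rewrite mulrC.
Qed.

Fact fps_inv_out : {in [predC fps_unit], fps_inv =1 id}.
Proof. by move=> f /negbTE nUf; rewrite /fps_inv nUf. Qed.

HB.instance Definition _ :=
  GRing.ComNzRing_hasMulInverse.Build (fps R)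
    fps_mulVx fps_unitPl fps_inv_out.

End FpsRing.

(* Elements (sigma, w) of C_k wr S_n.  Positions and values are numbered from *)
(* 0, which does not affect the order relations below.                        *)
Definition colored_perm (k n : nat) : predArgType :=
  ('S_n * n.-tuple 'I_k)%type.
HB.instance Definition _ k n := Finite.on (colored_perm k n).

Definition bi_avoids_12_10 (k n : nat) (x : colored_perm k n) : bool :=
  ~~ [exists i : 'I_n, exists j : 'I_n,
       [&& (i < j)%N, (x.1 i < x.1 j)%N & (tnth x.2 i > tnth x.2 j)%N]].

Definition bi_avoids_12_01 (k n : nat) (x : colored_perm k n) : bool :=
  ~~ [exists i : 'I_n, exists j : 'I_n,
       [&& (i < j)%N, (x.1 i < x.1 j)%N & (tnth x.2 i < tnth x.2 j)%N]].

Definition Av (n k : nat) : nat :=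
  #|[set x : colored_perm k n | bi_avoids_12_10 x & bi_avoids_12_01 x]|.

Definition Av_series (k : nat) : fps int := FPS (fun n => (Av n k)%:R).

Definition fact_series : fps int :=
  FPS (fun n => if n == 0%N then 0 else (n`!)%:R).

(* The convention for n = 0 needs no special case.                            *)
Lemma Av0 (k : nat) : Av 0 k = 1%N.
Proof.
rewrite /Av -[RHS](_ : #|[set: colored_perm k 0]| = _).
  apply: eq_card => x; rewrite !inE.
  by apply/andP; split; apply/existsPn => -[].
by rewrite cardsT card_prod card_Sn card_tuple expn0.
Qed.

(* Taken with a = k - 1: dividing by this series is a genuine division.       *)
Lemma fact_series_denom_unit (a : fps int) :
  1 - a * fact_series \is a GRing.unit.
Proof.
change (fps_coef (1 - a * fact_series) 0 \is a GRing.unit).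
by rewrite /= big_ord1 /= mulr0 subr0 unitr1.
Qed.

(* Main.v *)
Require Import Defs.
From mathcomp Require Import all_boot all_order all_algebra.
From mathcomp Require Import all_fingroup zify.
Import GRing.Theory.
Local Open Scope ring_scope.

(* Bi-avoiding both patterns means that sigma_i < sigma_j with i < j forces   *)
(* w_i = w_j.  If the initial run of equal colors of such an element has      *)
(* length j < n, then every value in the run exceeds every later value, so    *)
(* the element is a monochrome skew summand of size j followed by a           *)
(* bi-avoiding element of size n - j whose first color is different.          *)
(* Together with the k n! monochrome elements this gives                      *)
(*   Av_n = n! + (k - 1) \sum_(m < n) Av_m (n - m)!   for n > 0,              *)
(* which is the coefficientwise form of A (1 - (k - 1) C) = 1 + C.            *)

Local Open Scope nat_scope.

(** The decomposition is carried by [prepend_run], which is injective and, by [prepend_runP],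
    reaches every bi-avoiding element whose first run is proper. The run may take any color except
    the first one of the remainder, whence the factor k - 1 in [card_first_run]. Of the k n!
    elements of [card_monochrome], (k - 1) n! serve as the term m = 0 of [Av_rec]; the other n! is
    its free term. *)

Definition bi_avoiding {k n} : pred (colored_perm k n) :=
  [pred x | bi_avoids_12_10 x && bi_avoids_12_01 x].

Lemma bi_avoidingP {k n} (x : colored_perm k n) :
  reflect (forall i j : 'I_n, i < j -> x.1 i < x.1 j ->
             tnth x.2 i = tnth x.2 j)
          (bi_avoiding x).
Proof.
apply: (iffP andP) => [[/existsPn av10 /existsPn av01] i j ij xij | eq_w].
  have /existsPn/(_ j) := av10 i; have /existsPn/(_ j) := av01 i.
  rewrite ij xij /= -!leqNgt => ? ?.
  by apply/val_inj/eqP; rewrite eqn_leq; apply/andP.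
by split; apply/existsPn => i; apply/existsPn => j; apply/and3P => -[ij xij];
  rewrite (eq_w i j ij xij) ltnn.
Qed.

Section SkewSum.
Variables j m : nat.

(** Positions split as j + m but values as m + j, so the first block takes the j largest values;
    [cast_ord] reconciles the two splittings. *)
Definition skew_sum_fun (s : 'S_j) (t : 'S_m) (i : 'I_(j + m)) : 'I_(j + m) :=
  cast_ord (addnC m j)
    match split i with inl a => rshift m (s a) | inr b => lshift j (t b) end.

Lemma skew_sum_fun_inj s t : injective (skew_sum_fun s t).
Proof.
move=> x y /cast_ord_inj; rewrite -[x]splitK -[y]splitK !unsplitK.
case: (split x) (split y) => a [] b /= => [/rshift_inj/perm_inj->//|||].
- by move/eqP; rewrite eq_rlshift.
- by move/eqP; rewrite eq_lrshift.
- by move=> /lshift_inj/perm_inj->.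
Qed.

Definition skew_sum s t : 'S_(j + m) := perm (@skew_sum_fun_inj s t).

Lemma skew_suml s t a : skew_sum s t (lshift m a) = m + s a :> nat.
Proof. by rewrite permE /skew_sum_fun (unsplitK (inl a)). Qed.

Lemma skew_sumr s t b : skew_sum s t (rshift j b) = t b :> nat.
Proof. by rewrite permE /skew_sum_fun (unsplitK (inr b)). Qed.

Lemma skew_sum_inj s t s' t' :
  skew_sum s t = skew_sum s' t' -> s = s' /\ t = t'.
Proof.
move=> /permP eq_st; split; apply/permP => i; apply: val_inj.
  by have /(congr1 val) := eq_st (lshift m i); rewrite /= !skew_suml => /addnI.
by have /(congr1 val) := eq_st (rshift j i); rewrite /= !skew_sumr.
Qed.

(** By pigeonhole: the m right values all lie below each left value, which is therefore at least m,
    and the j left values all lie above each right value, which is therefore below m. *)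
Lemma skew_sumP (p : 'S_(j + m)) :
    (forall a b, p (rshift j b) < p (lshift m a)) ->
  exists s t, p = skew_sum s t.
Proof.
move=> lt_p.
have lbound a : m <= p (lshift m a).
  have inj_f : injective (fun b => Ordinal (lt_p a b)).
    by move=> b b' [/val_inj/perm_inj/rshift_inj].
  by have := leq_card _ inj_f; rewrite !card_ord.
have ubound b : p (rshift j b) < m.
  have lt_f a :
      p (lshift m a) - (p (rshift j b)).+1 < j + m - (p (rshift j b)).+1.
    by have := lt_p a b; have := ltn_ord (p (lshift m a)); lia.
  have inj_f : injective (fun a => Ordinal (lt_f a)).
    move=> a a' [eq_aa']; apply/(@lshift_inj _ m)/(@perm_inj _ p)/val_inj => /=.
    by have := lt_p a b; have := lt_p a' b; lia.
  have := leq_card _ inj_f; rewrite !card_ord.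
  by have := ltn_ord (p (rshift j b)); lia.
have lt_s a : p (lshift m a) - m < j.
  by have := lbound a; have := ltn_ord (p (lshift m a)); lia.
have s_inj : injective (fun a => Ordinal (lt_s a)).
  move=> a a' [eq_aa']; apply/(@lshift_inj _ m)/(@perm_inj _ p)/val_inj => /=.
  by have := lbound a; have := lbound a'; lia.
have t_inj : injective (fun b => Ordinal (ubound b)).
  by move=> b b' [/val_inj/perm_inj/rshift_inj].
exists (perm s_inj), (perm t_inj); apply/permP => x; apply: val_inj => /=.
rewrite -[x]splitK; case: (split x) => [a | b] /=.
  by rewrite skew_suml permE /= subnKC.
by rewrite skew_sumr permE.
Qed.

End SkewSum.

Arguments skew_sum {j m}.

Section FirstRun.
Variable k : nat.

(** As [find] returns the size when it fails, a monochrome word has its full length as first run.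
    With [k.+1] colors, [k] here is k - 1 in the theorem. *)
Definition first_run (w : seq 'I_k.+1) : nat := find (predC1 (head ord0 w)) w.

Lemma first_run_gt0 w : 0 < size w -> 0 < first_run w.
Proof. by case: w => //= c w _; rewrite /first_run /= eqxx. Qed.

Lemma first_run_cat j c (u : seq 'I_k.+1) :
  head ord0 u != c -> 0 < size u -> first_run (nseq j.+1 c ++ u) = j.+1.
Proof.
case: u => //= d u dc _.
rewrite /first_run /= eqxx /= find_cat has_nseq /= eqxx.
by rewrite andbF size_nseq /= dc addn0.
Qed.

Lemma first_runP j m (w : (j.+1 + m.+1).-tuple 'I_k.+1) :
    first_run w = j.+1 ->
  (forall a, tnth w (lshift m.+1 a) = tnth w ord0)
    /\ tnth w (rshift j.+1 ord0) != tnth w ord0.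
Proof.
move=> wj.
have w0 : head ord0 w = tnth w ord0 by rewrite (tnth_nth ord0) nth0.
split=> [a|].
  rewrite [LHS](tnth_nth ord0) -w0; apply/eqP/negPn.
  have /= -> // := @before_find _ ord0 (predC1 (head ord0 w)) w a.
  by rewrite -/(first_run w) wj.
have hw : has (predC1 (head ord0 w)) w.
  by rewrite has_find -/(first_run w) wj size_tuple addnS ltnS leq_addr.
have := nth_find ord0 hw; rewrite -/(first_run w) wj /= w0.
by rewrite [tnth w (rshift _ _)](tnth_nth ord0) /= addn0.
Qed.

(** For c in ['I_k], [lift (thead u) c] enumerates the colors other than the first color of [u]. The
    remainder is nonempty so that this color exists. *)
Definition prepend_run {j m}
    (z : 'S_j.+1 * colored_perm k.+1 m.+1 * 'I_k) :
    colored_perm k.+1 (j.+1 + m.+1) :=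
  let: (s, (t, u), c) := z in
  (skew_sum s t, [tuple of nseq j.+1 (lift (thead u) c) ++ u]).

Lemma prepend_run_inj j m : injective (@prepend_run j m).
Proof.
move=> [[s [t u]] c] [[s' [t' u']] c'] [/skew_sum_inj[-> ->] eq_c eq_w].
have eq_u : u = u'.
  apply: val_inj; move/eqP: eq_w; rewrite eqseq_cat ?size_nseq //.
  by case/andP => _ /eqP.
by move: eq_c; rewrite eq_u => /(can_inj (bumpK _))/val_inj->.
Qed.

(** Pairs inside the run share a color and pairs across the blocks are inversions, so only pairs
    inside the remainder impose a condition. *)
Lemma bi_avoiding_prepend_run j m z :
  bi_avoiding (@prepend_run j m z) = bi_avoiding z.1.2.
Proof.
case: z => [[s [t u]] c]; apply/bi_avoidingP/bi_avoidingP => /= av x y xy.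
  move=> txy; have := av (rshift j.+1 x) (rshift j.+1 y).
  by rewrite !skew_sumr !tnth_rshift /= ltn_add2l; apply.
move: xy; rewrite -[x]splitK -[y]splitK.
case: (split x) (split y) => a [] b /=.
- by rewrite !tnth_lshift !(tnth_nth (lift (thead u) c)) !nth_nseq !ltn_ord.
- by rewrite skew_suml skew_sumr; have := ltn_ord (t b); lia.
- by have := ltn_ord b; lia.
- by rewrite !skew_sumr !tnth_rshift /= ltn_add2l; apply: av.
Qed.

Lemma first_run_prepend_run j m z : first_run (@prepend_run j m z).2 = j.+1.
Proof.
case: z => [[s [t u]] c] /=; apply: first_run_cat; last by rewrite size_tuple.
by rewrite -nth0 -[nth _ _ _](tnth_nth ord0 u ord0) neq_lift.
Qed.

Lemma prepend_runP j m (x : colored_perm k.+1 (j.+1 + m.+1)) :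
  bi_avoiding x -> first_run x.2 = j.+1 -> exists z, x = prepend_run z.
Proof.
case: x => [p w] /bi_avoidingP /= av /first_runP [w_l w_r].
have lt_p0 a : p (rshift j.+1 ord0) < p (lshift m.+1 a).
  rewrite ltnNge leq_eqVlt negb_or; apply/andP; split.
    by apply/eqP => /val_inj/perm_inj/eqP; rewrite eq_lrshift.
  apply/negP => /(av (lshift m.+1 a)).
  rewrite /= addn0 ltn_ord => /(_ isT) eq_w.
  by rewrite -eq_w w_l eqxx in w_r.
(* If a later value exceeded a run value, it would carry the run color; it would also exceed the
   first value after the run, by [lt_p0], and so share that value's different color. *)
have lt_p a b : p (rshift j.+1 b) < p (lshift m.+1 a).
  rewrite ltnNge leq_eqVlt negb_or; apply/andP; split.
    by apply/eqP => /val_inj/perm_inj/eqP; rewrite eq_lrshift.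
  apply/negP => lt_ab.
  have eq_ab : tnth w (lshift m.+1 a) = tnth w (rshift j.+1 b).
    by apply: av => //=; have := ltn_ord a; lia.
  have [b0 | b_gt0] := posnP b.
    have {}b0 : b = ord0 by apply: val_inj.
    by have := lt_p0 a; rewrite -b0; lia.
  have eq_0b : tnth w (rshift j.+1 ord0) = tnth w (rshift j.+1 b).
    by apply: av => /=; [lia | exact: ltn_trans (lt_p0 a) lt_ab].
  by rewrite eq_0b -eq_ab w_l eqxx in w_r.
have [s [t ->]] := skew_sumP _ _ _ lt_p.
pose u := [tuple tnth w (rshift j.+1 i) | i < m.+1].
have u0 : thead u = tnth w (rshift j.+1 ord0) by rewrite /thead tnth_mktuple.
rewrite -u0 in w_r; have [c Dc _] := unlift_some w_r.
exists (s, (t, u), c); congr pair; apply: eq_from_tnth => i.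
rewrite -[i]splitK; case: (split i) => [a | b] /=.
  by rewrite tnth_lshift w_l Dc (tnth_nth (lift (thead u) c)) nth_nseq ltn_ord.
by rewrite tnth_rshift tnth_mktuple.
Qed.

Lemma card_first_run j m :
  #|[set x : colored_perm k.+1 (j.+1 + m.+1)
       | bi_avoiding x && (first_run x.2 == j.+1)]|
    = k * (Av m.+1 k.+1 * j.+1`!).
Proof.
pose D :=
  [set z : 'S_j.+1 * colored_perm k.+1 m.+1 * 'I_k | bi_avoiding z.1.2].
transitivity #|prepend_run @: D|.
  apply: eq_card => x; rewrite !inE; apply/andP/imsetP.
    case=> av /eqP/(prepend_runP _ _ _ av)[z Dx]; exists z => //.
    by rewrite inE -bi_avoiding_prepend_run -Dx.
  case=> z; rewrite inE => av ->.
  by rewrite bi_avoiding_prepend_run first_run_prepend_run.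
rewrite (card_imset _ (@prepend_run_inj j m)).
transitivity #|setX (setX [set: 'S_j.+1]
  [set y : colored_perm k.+1 m.+1 | bi_avoiding y]) [set: 'I_k]|.
  by apply: eq_card => z; rewrite !inE andbT.
by rewrite !cardsX !cardsT card_Sn card_ord mulnC (mulnC _`!).
Qed.

Lemma card_monochrome n :
  #|[set x : colored_perm k.+1 n.+1
       | bi_avoiding x && (first_run x.2 == n.+1)]| = k.+1 * n.+1`!.
Proof.
pose f (z : 'S_n.+1 * 'I_k.+1) : colored_perm k.+1 n.+1 :=
  (z.1, [tuple of nseq n.+1 z.2]).
have f_inj : injective f by move=> [s c] [s' c'] [/= -> ->].
transitivity #|f @: [set: 'S_n.+1 * 'I_k.+1]|; last first.
  by rewrite card_imset // cardsT card_prod card_Sn card_ord mulnC.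
apply: eq_card => -[p w]; rewrite !inE; apply/andP/imsetP => /=.
  case=> _ /eqP run_w; exists (p, head ord0 w); first by rewrite inE.
  congr pair; apply: val_inj => /=; suff /all_pred1P: all (pred1 (head ord0 w)) w.
    by rewrite (size_tuple w).
  rewrite -[all _ _]negbK -has_predC has_find -/(first_run w) run_w.
  by rewrite size_tuple ltnn.
case=> [[s c] _ [-> ->]]; split.
  apply/bi_avoidingP => i j _ _.
  exact: etrans (tnth_nseq c i) (esym (tnth_nseq c j)).
by rewrite /first_run hasNfind ?size_tuple //= has_nseq /= eqxx andbF.
Qed.

Lemma Av_rec n :
  Av n.+1 k.+1 = n.+1`! + k * \sum_(m < n.+1) Av m k.+1 * (n.+1 - m)`!.
Proof.
have run_le (x : colored_perm k.+1 n.+1) : 0 < first_run x.2 <= n.+1.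
  rewrite first_run_gt0 ?size_tuple //=.
  by rewrite -[X in _ <= X](size_tuple x.2) find_size.
(* The classes are indexed by the size of the remainder, which is below [n.+1] because the run is
   nonempty. *)
rewrite [LHS]/Av -sum1_card (partition_big
  (fun x : colored_perm k.+1 n.+1 =>
     inord (n.+1 - first_run x.2) : 'I_n.+1) predT) //=.
rewrite big_distrr /= !big_ord_recl /= Av0 mul1n subn0 addnA; congr addn.
  rewrite -[n.+1`! + _]/(k.+1 * n.+1`!) -card_monochrome -sum1_card.
  apply: eq_bigl => x; rewrite !inE; congr andb.
  by have run_x := run_le x; rewrite -val_eqE /= inordK; lia.
apply: eq_bigr => m _; rewrite /bump /= add1n subSS.
have := ltn_ord m; case: n run_le m => [|n] run_le m lt_mn; first by lia.
have [j Dn] : exists j, n.+2 = j.+1 + m.+1 by exists (n - m); lia.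
have -> : n.+1 - m = j.+1 by lia.
rewrite -card_first_run -sum1_card.
(* [n.+2] and [j.+1 + m.+1] are only propositionally equal, so the set is first described over
   [n.+2], where [Dn] can rewrite the type. *)
transitivity (\sum_(x in [set x : colored_perm k.+1 n.+2
                           | bi_avoiding x & first_run x.2 == j.+1]) 1);
  last by rewrite Dn.
apply: eq_bigl => x; rewrite !inE; congr andb.
by have run_x := run_le x; rewrite -val_eqE /= /bump inordK; lia.
Qed.

End FirstRun.

Local Open Scope ring_scope.

Lemma fps_coefMn (R : comUnitRingType) (f : fps R) n i :
  fps_coef (f *+ n) i = fps_coef f i *+ n.
Proof. by elim: n => // n IHn; rewrite !mulrS -IHn. Qed.

Theorem theorem9 (k : nat) (hk : (1 <= k)%N) :
  Av_series k = (1 + fact_series) / (1 - (k%:R - 1) * fact_series).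
Proof.
rewrite -[LHS](mulrK (fact_series_denom_unit (k%:R - 1))); congr (_ / _).
case: k hk => // k _; rewrite mulrSr addrK mulrBr mulr1 mulrCA mulr_natl.
apply/fpsP => n; rewrite /= fps_coefMn /=.
case: n => [|n]; first by rewrite big_ord1 Av0 mulr0 mul0rn subr0.
(* The zero constant term of [fact_series] removes the last term of the convolution, leaving the
   range of summation of [Av_rec]. *)
rewrite add0r /= big_ord_recr /= subnn mulr0 addr0 Av_rec.
apply/eqP; rewrite subr_eq natrD natrM mulr_natl natr_sum; apply/eqP.
congr (_ + _ *+ _); apply: eq_bigr => m _.
by rewrite natrM ifN // -lt0n subn_gt0.
Qed.
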